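(* Let $p\in(1,\infty)$, $X\in\mathfrak A_p$, $\theta\in[0,p)$, $S\in\mathcal{LCR}_\theta(X)$ closed, and $\{\mathfrak m_k\}\in\mathfrak M^{str}_\theta(S)$ with parameter $\epsilon\in(0,\frac1{10}]$. Let $f\in L^1_{loc}(\{\mathfrak m_k\})$ (a fixed Borel representative on $S$) satisfy $\operatorname{BSN}^\delta_{p,c}(f)<+\infty$ for some $c>1$ and $\delta\in(0,1]$. Then $\mathfrak m_0$-almost every point of $S$ is an $(\{\mathfrak m_k\},\epsilon)$-Lebesgue point of $f$, i.e. $\mathfrak m_0(S\setminus\mathfrak R_{\{\mathfrak m_k\},\epsilon}(f))=0$.
   Context: A metric measure space is a triple $X=(X,d,\mu)$ with $(X,d)$ a complete separable metric space and $\mu$ a Borel regular measure with $0<\mu(B)<\infty$ for every ball $B$ and $\operatorname{supp}\mu=X$. All balls are closed: $B_r(x)=\{y:d(x,y)\le r\}$; $\lambda B_r(x)=B_{\lambda r}(x)$, $r(B)$ is the radius. A measure on $X$ means a nonzero Borel regular locally finite (outer) measure. $\mu$ is uniformly locally doubling if for every $R>0$, $\sup_{r\in(0,R]}\sup_x\mu(B_{2r}(x))/\mu(B_r(x))<\infty$. $\operatorname{lip}f(x)=\limsup_{y\to x}|f(y)-f(x)|/d(x,y)$ at accumulation points and $0$ otherwise. For a measure $\mathfrak m$ and Borel $G$ with $0<\mathfrak m(G)<\infty$, $\mathcal E_{\mathfrak m}(f,G)=\inf_{c\in\mathbb R}\frac1{\mathfrak m(G)}\int_G|f-c|d\mathfrak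 m$. $X\in\mathfrak A_q$ if $\mu$ is uniformly locally doubling and for every $R>0$ there are $C>0,\lambda\ge1$ with $\mathcal E_\mu(f,B_r(x))\le Cr(\frac1{\mu(B_{\lambda r}(x))}\int_{B_{\lambda r}(x)}(\operatorname{lip}f)^qd\mu)^{1/q}$ for all Lipschitz $f$, $x$, $r\in(0,R]$. For $\theta\ge0$: $\mathcal H_{\theta,\delta}(E)=\inf\{\sum_i\mu(B_{r_i}(x_i))/r_i^\theta:E\subset\bigcup_iB_{r_i}(x_i),\ r_i<\delta\}$. $S\in\mathcal{LCR}_\theta(X)$ if there is $\lambda>0$ with $\mathcal H_{\theta,r}(B_r(x)\cap S)\ge\lambda\mu(B_r(x))/r^\theta$ for all $x\in S$, $r\in(0,1]$. $\{\mathfrak m_k\}_{k=0}^\infty\in\mathfrak M_\theta(S)$ (parameter $\epsilon$) means: (M1) $\operatorname{supp}\mathfrak m_k=S$; (M2) $\exists C_1$: $\mathfrak m_k(B_r(x))\le C_1\mu(B_r(x))/r^\theta$ for all $k$, $x\in X$, $r\in(0,\epsilon^k]$; (M3) $\exists C_2$: $\mathfrak m_k(B_r(x))\ge C_2\mu(B_r(x))/r^\theta$ for all $k$, $x\in S$, $r\in[\epsilon^k,1]$; (M4) $\mathfrak m_k=w_k\mathfrak m_0$, $w_k\in L^\infty(\mathfrak m_0)$, $\exists C_3$: $\epsilon^{\theta j}/C_3\le w_k/w_{k+j}\le C_3$ $\mathfrak m_0$-a.e. on $S$ for all $k,j$. $\mathfrak M^{str}_\theta(S)$ additionally requires (M5):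 for every Borel $E\subset S$, $\limsup_k\mathfrak m_k(B_{\epsilon^k}(x)\cap E)/\mathfrak m_k(B_{\epsilon^k}(x))>0$ for $\mathfrak m_0$-a.e. $x\in E$. $L^1_{loc}(\{\mathfrak m_k\})=\bigcap_kL^1_{loc}(\mathfrak m_k)$. For $r>0$, $k(r)=\max\{k\in\mathbb Z:r\le\epsilon^k\}$; $k(B)=k(r(B))$. $\widetilde{\mathcal E}_{\mathfrak m}(f,B_r(x))=\mathcal E_{\mathfrak m}(f,B_{2r}(x))$ if $B_r(x)\cap\operatorname{supp}\mathfrak m\ne\emptyset$, else $0$. A finite family of closed balls $\{B_{r_i}(x_i)\}$ is $(S,c,\delta)$-nice if the balls are pairwise disjoint, $\max_ir_i\le\delta$, and $B_{cr_i}(x_i)\cap S\ne\emptyset$ for all $i$. $\operatorname{BSN}^\delta_{p,c}(f)=\|f\|_{L^p(\mathfrak m_0)}+\sup\big(\sum_{B\in\mathcal B}\mu(B)r(B)^{-p}\widetilde{\mathcal E}_{\mathfrak m_{k(B)}}(f,cB)^p\big)^{1/p}$, supremum over all $(S,c,\delta)$-nice families. A point $x\in S$ is an $(\{\mathfrak m_k\},\epsilon)$-Lebesgue point of $f$ if $\lim_{r\to0}\frac1{\mathfrak m_{k(r)}(B_r(x))}\int_{B_r(x)}|f(x)-f(y)|\,d\mathfrak m_{k(r)}(y)=0$; $\mathfrak R_{\{\mathfrak m_k\},\epsilon}(f)$ is the set of such points. *)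

(* Defs.v *)
From HB Require Import structures.
From mathcomp Require Import all_boot all_order all_algebra.
From mathcomp Require Import all_classical all_reals all_analysis.
Set Implicit Arguments. Unset Strict Implicit. Unset Printing Implicit Defensive.
Import Order.TTheory GRing.Theory Num.Theory.
Import numFieldNormedType.Exports.
Local Open Scope classical_set_scope.
Local Open Scope ring_scope.

Section Metric.
Context {R : realType} {T : Type}.
Variable dist : T -> T -> R.

Definition is_metric : Prop :=
  (forall x y, dist x y = 0 <-> x = y) /\
  (forall x y, dist x y = dist y x) /\
  (forall x y z, dist x z <= dist x y + dist y z).

Definition dcauchy (u : nat -> T) : Prop :=
  forall e, 0 < e -> exists N, forall n k, (N <= n)%N -> (N <= k)%N ->
    dist (u n) (u k) < e.

Definition dcomplete : Prop :=
  forall u, dcauchy u -> exists l, forall e, 0 < e ->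
    exists N, forall n, (N <= n)%N -> dist (u n) l < e.

Definition dseparable : Prop :=
  exists D : set T, countable D /\
    forall x e, 0 < e -> exists y, D y /\ dist x y < e.

Definition cball (x : T) (r : R) : set T := [set y | dist x y <= r].

Definition dopen (U : set T) : Prop :=
  forall x, U x -> exists r, 0 < r /\ cball x r `<=` U.

Definition dclosed (S : set T) : Prop :=
  forall x, (forall r, 0 < r -> exists y, S y /\ dist x y <= r) -> S x.

Definition dlipschitz (f : T -> R) : Prop :=
  exists L : R, forall x y, `|f x - f y| <= L * dist x y.

Definition accumulation_pt (x : T) : Prop :=
  forall r, 0 < r -> exists y, 0 < dist x y < r.

(* lip f (x) = limsup_{y -> x} |f y - f x| / d(x,y) at accumulation
   points, 0 otherwise (real-valued; finite for Lipschitz f) *)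
Definition lipc (f : T -> R) (x : T) : R :=
  if `[< accumulation_pt x >] then
    fine (ereal_inf [set ereal_sup [set (`|f y - f x| / dist x y)%:E
                                   | y in [set y | 0 < dist x y < r]]
                    | r in [set r : R | 0 < r]])
  else 0.

End Metric.

Section MeasureDefs.
Context {R : realType} {dd : measure_display} {T : measurableType dd}.
Variable dist : T -> T -> R.
Local Notation B := (cball dist).

Definition borel_compatible : Prop :=
  (measurable : set (set T)) = <<s dopen dist >>.

Definition mm_space (mu : {measure set T -> \bar R}) : Prop :=
  [/\ is_metric dist, dcomplete dist, dseparable dist, borel_compatible &
      forall x r, 0 < r -> (0 < mu (B x r))%E /\ (mu (B x r) < +oo)%E].

Definition nz_loc_finite (m : {measure set T -> \bar R}) : Prop :=
  (exists A, measurable A /\ (0 < m A)%E) /\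
  (forall x, exists r, 0 < r /\ (m (B x r) < +oo)%E).

Definition supp (m : set T -> \bar R) : set T :=
  [set x | forall r, 0 < r -> (0 < m (B x r))%E].

Definition unif_loc_doubling (mu : {measure set T -> \bar R}) : Prop :=
  forall Rr : R, 0 < Rr -> exists C : R, forall (x : T) (r : R), 0 < r <= Rr ->
    (mu (B x (2 * r)) <= C%:E * mu (B x r))%E.

Definition osc (m : set T -> \bar R) (f : T -> R) (G : set T) : \bar R :=
  ereal_inf [set (((fine (m G))^-1)%:E * \int[m]_(x in G) (`|f x - c|)%:E)%E
            | c in [set: R]].

Definition frakA (mu : {measure set T -> \bar R}) (q : R) : Prop :=
  unif_loc_doubling mu /\
  forall Rr : R, 0 < Rr -> exists C lam : R, 0 < C /\ 1 <= lam /\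
    forall f : T -> R, dlipschitz dist f -> forall (x : T) (r : R), 0 < r <= Rr ->
      (osc mu f (B x r) <=
        (C * r)%:E *
        poweR (((fine (mu (B x (lam * r))))^-1)%:E *
               \int[mu]_(y in B x (lam * r)) ((lipc dist f y) `^ q)%:E) q^-1)%E.

(* H_{theta,delta}(E): countable (possibly finite) coverings indexed by I *)
Definition hcontent (mu : {measure set T -> \bar R}) (theta delta : R)
    (E : set T) : \bar R :=
  ereal_inf [set s | exists (I : set nat) (xs : nat -> T) (rs : nat -> R),
     [/\ forall i, I i -> 0 < rs i < delta,
         E `<=` \bigcup_(i in I) B (xs i) (rs i) &
         s = (\sum_(i <oo | i \in I)
                (mu (B (xs i) (rs i)) * ((rs i `^ theta)^-1)%:E))%E]].

Definition LCR (mu : {measure set T -> \bar R}) (theta : R) (S : set T) : Prop :=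
  exists lam : R, 0 < lam /\ forall x r, S x -> 0 < r <= 1 ->
    (lam%:E * mu (B x r) * ((r `^ theta)^-1)%:E
       <= hcontent mu theta r (B x r `&` S))%E.

(* k(r) = max{k : r <= eps^k} (a natural number for 0 < r <= 1) *)
Definition kr (eps r : R) : nat :=
  xget 0%N [set n : nat | r <= eps ^+ n /\ eps ^+ n.+1 < r].

Definition frakM (mu : {measure set T -> \bar R}) (theta eps : R) (S : set T)
    (m : nat -> {measure set T -> \bar R}) : Prop :=
  [/\ (forall k, nz_loc_finite (m k)),
      (* M1 *) (forall k, supp (m k) = S),
      (* M2 *) (exists C1 : R, 0 < C1 /\ forall k x r, 0 < r <= eps ^+ k ->
                 (m k (B x r) <= C1%:E * mu (B x r) * ((r `^ theta)^-1)%:E)%E),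
      (* M3 *) (exists C2 : R, 0 < C2 /\ forall k x r, S x -> eps ^+ k <= r <= 1 ->
                 (C2%:E * mu (B x r) * ((r `^ theta)^-1)%:E <= m k (B x r))%E) &
      (* M4 *) (exists w : nat -> T -> R,
                 [/\ forall k, measurable_fun setT (w k),
                     forall k, exists M : R, {ae m 0%N, forall x, `|w k x| <= M},
                     forall k A, measurable A ->
                        m k A = (\int[m 0%N]_(x in A) (w k x)%:E)%E &
                     exists C3 : R, 0 < C3 /\ forall k j : nat,
                       {ae m 0%N, forall x, S x ->
                          eps `^ (theta * j%:R) / C3 <= w k x / w (k + j)%N x <= C3}])].

Definition M5 (eps : R) (S : set T) (m : nat -> {measure set T -> \bar R}) : Prop :=
  forall E, measurable E -> E `<=` S ->
    {ae m 0%N, forall x, E x ->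
       0 < limn_sup (fun k => fine (m k (B x (eps ^+ k) `&` E)) /
                              fine (m k (B x (eps ^+ k))))}.

Definition frakMstr mu theta eps S m : Prop :=
  frakM mu theta eps S m /\ M5 eps S m.

Definition L1loc (m : nat -> {measure set T -> \bar R}) (f : T -> R) : Prop :=
  forall k x r, 0 < r -> (m k).-integrable (B x r) (EFin \o f).

Definition osct (m : set T -> \bar R) (f : T -> R) (x : T) (r : R) : \bar R :=
  if `[< B x r `&` supp m !=set0 >] then osc m f (B x (2 * r)) else 0%E.

Definition nice (S : set T) (c delta : R) (n : nat) (xs : nat -> T)
    (rs : nat -> R) : Prop :=
  (forall i, (i < n)%N -> 0 < rs i <= delta /\ B (xs i) (c * rs i) `&` S !=set0) /\
  (forall i j, (i < n)%N -> (j < n)%N -> i <> j ->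
     B (xs i) (rs i) `&` B (xs j) (rs j) = set0).

Definition BSN (mu : {measure set T -> \bar R}) (m : nat -> {measure set T -> \bar R})
    (eps : R) (S : set T) (p c delta : R) (f : T -> R) : \bar R :=
  (Lnorm (m 0%N) p%:E (EFin \o f) +
   ereal_sup [set s | exists n xs rs, nice S c delta n xs rs /\
     s = poweR (\sum_(i < n)
          (mu (B (xs i) (rs i)) * ((rs i) `^ (- p))%:E *
           poweR (osct (m (kr eps (rs i))) f (xs i) (c * rs i)) p)) p^-1])%E.

Definition leb_avg (m : nat -> {measure set T -> \bar R}) (eps : R) (f : T -> R)
    (x : T) (r : R) : \bar R :=
  (((fine (m (kr eps r) (B x r)))^-1)%:E *
   \int[m (kr eps r)]_(y in B x r) (`|f x - f y|)%:E)%E.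

Definition lebesgue_pts (m : nat -> {measure set T -> \bar R}) (eps : R)
    (S : set T) (f : T -> R) : set T :=
  [set x | S x /\ (leb_avg m eps f x r @[r --> 0^'+] --> 0%E)].

End MeasureDefs.

(* Main.v *)
Require Import Defs.
From mathcomp Require Import all_boot all_order all_algebra.
From mathcomp Require Import all_classical all_reals all_analysis.
From mathcomp Require Import measurable_realfun ring lra.
Set Implicit Arguments.
Unset Strict Implicit.
Import Order.TTheory GRing.Theory Num.Theory.
Import numFieldNormedType.Exports.
Local Open Scope classical_set_scope.
Local Open Scope ring_scope.

(** Write [G_k = B x (2 c eps^k)].  Disjoint balls of radius [eps^k] centred where
    the oscillation of [f] on [G_k] exceeds [tau^k] form a nice family, so finiteness
    of the BSN functional bounds the [m_0]-measure of that bad set by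
    [C eps^(k (p - theta)) / tau^(k p)].  For [tau = eps^((p - theta) / (2 p))] this is
    summable, and by Borel-Cantelli almost every [x] in [S] has oscillation at most
    [tau^k] at all small scales.  At such [x] there are constants [a_k] with
    [int_(G_k) |f - a_k| dm_k <= C tau^k m_k(G_k)], and comparability of consecutive
    [m_k] together with doubling gives [|a_k - a_n| <= C tau^k] for [n >= k].
    Condition (M5), applied to the level sets [{|f - q| < h}] with [q] rational, shows
    that [f x] is a limit point of [a_k], hence [|a_k - f x| <= C tau^k]; this is
    the Lebesgue point property with a rate. *)

(** * Closed balls, density and a one-scale covering in a metric space *)

Section MetricFacts.
Context {R : realType} {T : Type} {dist : T -> T -> R}.
Hypothesis dmetric : is_metric dist.
Local Notation B := (cball dist).

Lemma distxx x : dist x x = 0.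
Proof. by apply/(dmetric.1 x x). Qed.

Lemma distC x y : dist x y = dist y x.
Proof. exact: dmetric.2.1. Qed.

Lemma dist_triangle y x z : dist x z <= dist x y + dist y z.
Proof. exact: dmetric.2.2. Qed.

Lemma cball_center x r : 0 <= r -> B x r x.
Proof. by rewrite /cball /= distxx. Qed.

Lemma subset_cball x y r s : dist x y + s <= r -> B y s `<=` B x r.
Proof.
move=> h z; rewrite /cball /= => yz.
by have := dist_triangle y x z; lra.
Qed.

Lemma subset_cball_radius x r s : s <= r -> B x s `<=` B x r.
Proof. by move=> sr; apply: subset_cball; rewrite distxx add0r. Qed.

Lemma dopen_setC_cball x r : dopen dist (~` B x r).
Proof.
move=> y /negP; rewrite -ltNge => ry.
exists ((dist x y - r) / 2); split; first by lra.
move=> z; rewrite /cball /= => yz xz.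
have := dist_triangle z x y; rewrite (distC z y); lra.
Qed.

Lemma dopen_setC_dclosed S : dclosed dist S -> dopen dist (~` S).
Proof.
move=> cS x Sx; apply: contrapT => h; apply: Sx; apply: cS => r r0.
apply: contrapT => h'; apply: h; exists r; split=> // y xy Sy.
by apply: h'; exists y.
Qed.

Lemma dense_sequence : dseparable dist -> T ->
  exists d : nat -> T, forall x e, 0 < e -> exists n, dist x (d n) < e.
Proof.
move=> [D [cD dD]] x0; have /pfcard_geP[D0|[g]] := cD.
  by have [y [+ _]] := dD x0 1 ltr01; rewrite D0.
exists g => x e /(dD x)[y [Dy xy]].
by have [n _ gn] := 'surj_g Dy; exists n; rewrite gn.
Qed.

(* Vitali covering at a single scale; a countable index set is obtained by choosing,
   for each point of a dense sequence, one nearby point of A. *)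
Lemma disjoint_cball_cover (A : set T) r : dseparable dist -> 0 < r ->
  A !=set0 ->
  exists (D : set nat) (a : nat -> T), [/\ forall n, D n -> A (a n),
    trivIset D (fun n => B (a n) r) &
    A `<=` \bigcup_(n in D) B (a n) (3 * r)].
Proof.
move=> sepT r0 [x0 Ax0]; have [d dd] := dense_sequence sepT x0.
pose P n y := A y /\ dist y (d n) < r / 2.
pose I := [set n | exists y, P n y].
have /choice[a aP] n : exists y, I n -> P n y.
  by have [[y Py]|nI] := pselect (I n); [exists y|exists x0].
have [D [DI tD maxD]] :=
  ex_maximal_disjoint_subcollection (fun n => B (a n) r) I.
exists D, a; split=> // [n /DI /aP[]//|x Ax].
have [n xn] := dd x (r / 2) (divr_gt0 r0 (ltr0n R 2)).
have In : I n by exists x.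
have xa : dist x (a n) <= r.
  have [_ an] := aP _ In; have := dist_triangle (d n) x (a n).
  by rewrite (distC (d n)); lra.
have [Dn|Dn] := pselect (D n).
  by exists n => //; rewrite /cball /= distC; lra.
(* If the tripled balls missed [x], the ball of [n] could be added without losing disjointness,
   against maximality of [D]. *)
have : ~ trivIset (D `|` [set n]) (fun n => B (a n) r).
  apply: maxD; last by move=> i [/DI//|->].
  split; first by left.
  by move=> /(_ n (or_intror erefl)).
move=> nt; apply: contrapT => xcov; apply: nt.
(* A common point [z] gives [dist (a j) x <= r + r + r], the last [r] coming from
   [dist x (a n) <= r]; this is the source of the factor 3. *)
have disj j z : D j -> B (a j) r z -> B (a n) r z -> False.
  move=> Dj; rewrite /cball /= => jz nz; apply: xcov; exists j => //.
  rewrite /cball /=; have := dist_triangle z (a j) x.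
  have := dist_triangle (a n) z x; rewrite (distC z (a n)) (distC (a n) x); lra.
move=> i j [Di|->] [Dj|->] // [z [zi zj]]; first by apply: tD => //; exists z.
  by case: (disj i z).
by case: (disj j z).
Qed.

End MetricFacts.

(** * Borel measurability and the support of a measure *)

Section BorelFacts.
Context {R : realType} {dd : measure_display} {T : measurableType dd}.
Context {dist : T -> T -> R}.
Hypotheses (dmetric : is_metric dist) (borelT : borel_compatible dist).
Local Notation B := (cball dist).

Lemma measurable_dopen (U : set T) : dopen dist U -> measurable U.
Proof. by move=> oU; rewrite borelT; apply: sub_sigma_algebra. Qed.

Lemma measurable_cball x r : measurable (B x r).
Proof.
rewrite -(setCK (B x r)); apply: measurableC; apply: measurable_dopen.
exact: dopen_setC_cball.
Qed.

Lemma measurable_dclosed (S : set T) : dclosed dist S -> measurable S.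
Proof.
move=> cS; rewrite -(setCK S); apply: measurableC; apply: measurable_dopen.
exact: dopen_setC_dclosed.
Qed.

(** The space is a countable union of balls around one point; this turns local integrability into
    global measurability of [f]. *)
Lemma measurable_fun_cball (f : T -> R) :
  (forall x r, 0 < r -> measurable_fun (B x r) f) -> measurable_fun setT f.
Proof.
move=> mf; have [[x0 _]|T0] := pselect ([set: T] !=set0); last first.
  by move=> _ Y _; rewrite (_ : _ `&` _ = set0)//; apply/seteqP; split=> x //;
    case: T0; exists x.
have -> : [set: T] = \bigcup_n B x0 n.+1%:R.
  apply/esym/seteqP; split=> // x _; exists (Num.truncn (dist x0 x)) => //.
  by rewrite /cball /= ltW// truncnS_gt.
apply/measurable_fun_bigcup => [n|n]; first exact: measurable_cball.
by apply: mf.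
Qed.

(** The complement of the support is covered by those null balls whose centre lies in a dense
    sequence and whose radius is some [1/(n+1)], and these are countably many. *)
Lemma measure_setC_supp (m : {measure set T -> \bar R}) :
  dseparable dist -> measurable (supp dist m) -> m (~` supp dist m) = 0.
Proof.
move=> sepT mS; have [[x0 _]|T0] := pselect ([set: T] !=set0); last first.
  rewrite (_ : ~` _ = set0) ?measure0//; apply/seteqP; split=> x //.
  by move=> _; apply: T0; exists x.
have [d dd'] := dense_sequence sepT x0.
pose b n := B (d n.1) (n.2.+1%:R^-1).
pose N (n : nat * nat) := if m (b n) == 0 then b n else set0.
pose F k := if unpickle k is Some n then N n else set0.
have N0 n : m (N n) = 0 by rewrite /N; case: ifPn => [/eqP|] //; rewrite measure0.
have mN n : measurable (N n).
  by rewrite /N; case: ifP => // _; exact: measurable_cball.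
have : m.-negligible (\bigcup_k F k).
  apply: negligible_bigcup => k; rewrite /F; case: (unpickle k) => [n|].
    exact: (negligibleP m (mN n)).2 (N0 n).
  exact: negligible_set0.
move=> h; apply/(negligibleP m); first exact: measurableC.
apply: negligibleS h => x /existsNP[r /not_implyP[r0 /negP]].
rewrite -leNgt measure_le0 => /eqP mx.
(* Below [r / 2], a ball of radius [1/(j+1)] around a dense point that close to [x] contains [x] and
   lies inside the null ball [B x r]. *)
have [j j0] : exists j : nat, j.+1%:R^-1 < r / 2.
  have [j _ /(_ j (leqnn j))] := near_infty_natSinv_lt (PosNum (divr_gt0 r0 (ltr0n R 2))).
  by exists j.
have [n xn] := dd' x j.+1%:R^-1 ltac:(by rewrite invr_gt0).
exists (pickle (n, j)) => //; rewrite /F pickleK /N.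
suff -> : m (b (n, j)) == 0 by rewrite /b /cball/= (distC dmetric) ltW.
rewrite -measure_le0 -mx; apply: le_measure; rewrite ?inE;
  try exact: measurable_cball.
apply: (subset_cball dmetric) => /=; rewrite (splitr r) lerD// ltW//.
exact: lt_trans xn j0.
Qed.

End BorelFacts.

(** * Comparing measures given by densities *)

Section MeasureComparison.
Context {R : realType} {dd : measure_display} {T : measurableType dd}.
Implicit Types (m : {measure set T -> \bar R}) (w : T -> R) (C : R).

Lemma ge0_le_integral_dominated m1 m2 C (D : set T) (f : T -> \bar R) :
  0 <= C ->
  (forall A, measurable A -> (m1 A <= C%:E * m2 A)%E) ->
  measurable D -> (forall x, (0 <= f x)%E) -> measurable_fun [set: T] f ->
  (\int[m1]_(x in D) f x <= C%:E * \int[m2]_(x in D) f x)%E.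
Proof.
move=> C0 m12 mD f0 mf.
rewrite -(ge0_integral_mscale m2 mD (NngNum C0)) //; last first.
  exact: measurable_funTS.
exact: ge0_le_measure_integral.
Qed.

(** No sign is imposed on the densities in (M4). On [{w < 0}] the value of [m] is minus the integral
    of [|w|], so nonnegativity of [m] forces that integral to vanish. *)
Lemma density_ae_ge0 m0 m w : measurable_fun setT w ->
  (forall A, measurable A -> m A = (\int[m0]_(x in A) (w x)%:E)%E) ->
  {ae m0, forall x, 0 <= w x}.
Proof.
move=> mw mE; pose A := [set x | w x < 0].
have mA : measurable A.
  rewrite (_ : A = w @^-1` `]-oo, 0[); last first.
    by apply/seteqP; split=> x; rewrite /A /= in_itv.
  by rewrite -[X in measurable X]setTI; exact: mw.
have I0 : (\int[m0]_(x in A) `|(w x)%:E| = 0)%E.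
  have : (0 <= m A)%E by [].
  pose g x := `|(w x)%:E|%E.
  rewrite (mE A mA) (eq_integral (fun x => - g x)%E); last first.
    by move=> x; rewrite inE /A /g /= => wx; rewrite ltr0_norm// opprK.
  rewrite (integral_ge0N m0 (f := g)) ?oppe_ge0 => [I0|x _]; last exact: abse_ge0.
  by apply/eqP; rewrite eq_le I0 integral_ge0.
have mwA : measurable_fun A (EFin \o w).
  by apply/measurable_EFinP; exact: measurable_funTS.
have := (ae_eq_integral_abs m0 mA mwA).1 I0; apply: filterS => x /= wx0.
by rewrite leNgt; apply/negP => wx; have [w0] := wx0 wx; rewrite w0 ltxx in wx.
Qed.

Lemma density_dominated m0 m1 m2 w1 w2 C (A : set T) :
  measurable_fun setT w1 -> measurable_fun setT w2 ->
  (forall A, measurable A -> m1 A = (\int[m0]_(x in A) (w1 x)%:E)%E) ->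
  (forall A, measurable A -> m2 A = (\int[m0]_(x in A) (w2 x)%:E)%E) ->
  0 <= C -> {ae m0, forall x, w1 x <= C * w2 x} ->
  measurable A -> (m1 A <= C%:E * m2 A)%E.
Proof.
move=> mw1 mw2 m1E m2E C0 w12 mA.
(* Replacing [w] by its positive part leaves the integrals unchanged and makes the monotonicity
   results for nonnegative functions available. *)
have key m w : measurable_fun setT w ->
    (forall A, measurable A -> m A = (\int[m0]_(x in A) (w x)%:E)%E) ->
    m A = (\int[m0]_(x in A) (Num.max (w x) 0)%:E)%E.
  move=> mw mE; rewrite mE//; apply: ae_eq_integral => //.
  - by apply/measurable_EFinP; exact: measurable_funTS.
  - by apply/measurable_EFinP; apply: measurable_maxr => //;
      exact: measurable_funTS.
  - have := density_ae_ge0 mw mE; apply: filterS => x w0 _.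
    by rewrite /= max_l.
rewrite (key _ _ mw1 m1E) (key _ _ mw2 m2E).
have mmax w : measurable_fun setT w ->
    measurable_fun A (fun x => (Num.max (w x) 0)%:E).
  by move=> mw; apply/measurable_EFinP; apply: measurable_maxr => //;
      exact: measurable_funTS.
rewrite -ge0_integralZl_EFin//; last 2 first.
- by move=> x _; rewrite lee_fin le_max lexx orbT.
- exact: mmax.
apply: ae_ge0_le_integral => //.
- by move=> x _; rewrite lee_fin le_max lexx orbT.
- exact: mmax.
- by move=> x _; rewrite -EFinM lee_fin mulr_ge0// le_max lexx orbT.
- by apply: measurable_funeM; exact: mmax.
- move: w12; apply: filterS => x w12 _; rewrite -EFinM lee_fin ge_max.
  by rewrite mulr_ge0 ?le_max ?lexx ?orbT// andbT (le_trans w12)// ler_wpM2l// le_max lexx.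
Qed.

End MeasureComparison.

(** * Doubling and growth estimates for the family [m k] *)

Section MeasureFamily.
Context {R : realType} {dd : measure_display} {T : measurableType dd}.
Context {dist : T -> T -> R} {mu : {measure set T -> \bar R}}.
Context {theta eps : R} {S : set T} {m : nat -> {measure set T -> \bar R}}.
Hypotheses (mmT : mm_space dist mu) (dblT : unif_loc_doubling dist mu).
Hypotheses (theta0 : 0 <= theta) (clS : dclosed dist S).
Hypotheses (eps0 : 0 < eps) (eps10 : eps <= 10^-1).
Hypothesis mS : frakM dist mu theta eps S m.
Local Notation B := (cball dist).

Let dmetric : is_metric dist. Proof. by case: mmT. Qed.
Let sepT : dseparable dist. Proof. by case: mmT. Qed.
Let borelT : borel_compatible dist. Proof. by case: mmT. Qed.

Lemma unif_loc_doubling_scale (L : R) : exists2 C : R, 0 < C &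
  forall x r, 0 < r <= 1 -> (mu (B x (L * r)) <= C%:E * mu (B x r))%E.
Proof.
have [n Ln] : exists n : nat, L <= 2 ^+ n.
  exists (Num.truncn `|L|).+1; apply: (le_trans (ler_norm L)).
  by rewrite (le_trans (ltW (truncnS_gt _)))// -natrX ler_nat ltnW// ltn_expl.
(* The bound [2^n] covers every intermediate radius [2^i r] with [i < n], since [r <= 1]. *)
have [C0 dbl] := dblT (Rr := 2 ^+ n) ltac:(by rewrite exprn_gt0).
pose C := Num.max C0 1.
have C1 : 1 <= C by rewrite le_max lexx orbT.
exists (C ^+ n); first by rewrite exprn_gt0// (lt_le_trans ltr01).
move=> x r /andP[r0 r1].
suff : forall i, (i <= n)%N -> (mu (B x (2 ^+ i * r)) <= (C ^+ i)%:E * mu (B x r))%E.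
  move=> /(_ n (leqnn n)); apply: le_trans.
  apply: le_measure; rewrite ?inE; try exact: measurable_cball.
  by apply: subset_cball_radius => //; rewrite ler_pM2r.
elim=> [|i IH] ilt; first by rewrite !expr0 mul1r mul1e.
rewrite exprS -mulrA; apply: (le_trans (dbl _ _ _)).
  rewrite mulr_gt0 ?exprn_gt0//= -[leRHS]mulr1 ler_pM ?exprn_ge0 ?(ltW r0)//.
  by rewrite ler_weXn2l ?ler1n// ltnW.
rewrite exprS EFinM -muleA; apply: (@le_trans _ _ (C%:E * mu (B x (2 ^+ i * r)))%E).
  by rewrite lee_wpmul2r// lee_fin le_max lexx.
by rewrite lee_wpmul2l ?lee_fin ?(le_trans ler01)// IH// ltnW.
Qed.

Lemma frakM_null : m 0%N (~` S) = 0.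
Proof.
have [_ m_supp _ _ _] := mS; rewrite -(m_supp 0%N).
apply: (measure_setC_supp dmetric borelT sepT); rewrite m_supp.
exact: (measurable_dclosed borelT clS).
Qed.

(** The two sides of the ratio bound in (M4) give the two inequalities. The bound is stated on [S]
    only, which has full [m 0] measure by (M1). Only the second constant depends on the gap [j]. *)
Lemma frakM_comparable : exists (C : R) (D : nat -> R),
  [/\ 0 < C, forall j, 0 < D j & forall k j A, measurable A ->
    (m k A <= C%:E * m (k + j)%N A)%E /\
    (m (k + j)%N A <= (D j)%:E * m k A)%E].
Proof.
have [_ _ _ _ [w [mw _ wE [C3 [C30 wC3]]]]] := mS.
pose e j := eps `^ (theta * j%:R).
have e0 j : 0 < e j by rewrite powR_gt0.
exists C3, (fun j => C3 / e j); split=> // [j|k j A mA]; first exact: divr_gt0.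
have aeS : {ae m 0%N, forall x, S x}.
  by exists (~` S); split=> //; [exact/measurableC/(measurable_dclosed borelT)|exact: frakM_null].
have w0 i := density_ae_ge0 (mw i) (wE i).
have wpos : {ae m 0%N, forall x, [/\ 0 < w (k + j)%N x, w k x <= C3 * w (k + j)%N x &
    w (k + j)%N x <= C3 / e j * w k x]}.
  have := w0 (k + j)%N; have := wC3 k j; have := aeS.
  apply: filterS3 => x Sx /(_ Sx)/andP[le_r ge_r] wkj0.
  (* Division by zero returns zero, so a vanishing denominator would contradict the positive lower
     bound on the ratio. *)
  have : 0 < w (k + j)%N x.
    rewrite lt_neqAle wkj0 andbT; apply/eqP => wkj.
    move: le_r; rewrite -wkj invr0 mulr0 => /(lt_le_trans (divr_gt0 (e0 j) C30)).
    by rewrite ltxx.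
  move=> wkj_gt0; split=> //; first by rewrite -ler_pdivrMr.
  move: le_r; rewrite ler_pdivlMr// mulrAC ler_pdivrMr// -/(e j) => le_r.
  by rewrite mulrAC ler_pdivlMr// mulrC (mulrC C3).
split.
- apply: (density_dominated (mw k) (mw _) (wE k) (wE _) (ltW C30)) => //.
  by move: wpos; apply: filterS => x [].
- apply: (density_dominated (mw _) (mw k) (wE _) (wE k)) => //.
    by rewrite ltW// divr_gt0.
  by move: wpos; apply: filterS => x [].
Qed.

Let eps_lt1 : eps < 1. Proof. by apply: le_lt_trans eps10 _; lra. Qed.

Let epsX_le1 k : eps ^+ k <= 1.
Proof. by rewrite exprn_ile1// ltW. Qed.

Let mu_fin x r : 0 < r -> mu (B x r) = (fine (mu (B x r)))%:E.
Proof.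
move=> r0; have [_ _ _ _ /(_ x r r0)[h1 h2]] := mmT.
by rewrite fineK// ge0_fin_numE.
Qed.

Let powR_inv_le (r s : R) : 0 < r -> r <= s -> (s `^ theta)^-1 <= (r `^ theta)^-1.
Proof.
move=> r0 rs; have s0 := lt_le_trans r0 rs.
by rewrite lef_pV2 ?posrE ?powR_gt0// ge0_ler_powR// nnegrE ltW.
Qed.

(** Since [3 eps <= 1], the radius [3 eps^(k+1)] is admissible in (M2) for [m k]; comparability then
    passes to [m 0] with a constant independent of [k]. *)
Lemma frakM_triple_ball : exists2 C : R, 0 < C & forall k x,
  (m 0%N (B x (3 * eps ^+ k.+1)) <=
     C%:E * (mu (B x (eps ^+ k.+1)) * (((eps ^+ k.+1) `^ theta)^-1)%:E))%E.
Proof.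
have [C [D [C0 D0 mC]]] := frakM_comparable.
have [_ _ [C1 [C10 M2]] _ _] := mS.
have [CD CD0 dbl] := unif_loc_doubling_scale 3.
exists (C * C1 * CD); first by rewrite !mulr_gt0.
move=> k x; have mB r : measurable (B x r).
  exact: (measurable_cball dmetric borelT).
have ek0 n : 0 < eps ^+ n by rewrite exprn_gt0.
have [h _] := mC 0%N k _ (mB (3 * eps ^+ k.+1)).
rewrite -!mulrA EFinM -muleA; apply: (le_trans h); rewrite lee_wpmul2l ?lee_fin ?(ltW C0)//.
apply: (le_trans (M2 _ _ _ _)).
  rewrite mulr_gt0//= exprS mulrA ger_pMl//.
  by apply: (@le_trans _ _ (3 * 10^-1)); [rewrite ler_pM2l|lra].
rewrite -muleA EFinM -muleA lee_wpmul2l ?lee_fin ?(ltW C10)//.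
rewrite muleA; apply: lee_pmul => //.
- by rewrite lee_fin invr_ge0 powR_ge0.
- by rewrite dbl// ek0 epsX_le1.
- by rewrite lee_fin; apply: powR_inv_le => //; rewrite ler_peMl ?ltW//; lra.
Qed.

(** (M2) bounds the large ball from above, (M3) bounds the small one from below, and doubling
    compares the two [mu]-measures. The small radius is [eps^(k+1)] so that the estimate serves
    every [r] between [eps^(k+1)] and [eps^k]. *)
Lemma frakM_ball_growth (L : R) : 1 <= L -> exists (C : R) (j : nat), 0 < C /\
  forall k x, (j <= k)%N -> S x ->
  (m k (B x (L * eps ^+ k)) < +oo /\
   m k (B x (L * eps ^+ k)) <= C%:E * m k (B x (eps ^+ k.+1)))%E.
Proof.
move=> L1; have L0 : 0 < L by exact: lt_le_trans L1.
have [C [D [C0 D0 mC]]] := frakM_comparable.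
have [_ _ [C1 [C10 M2]] [C2 [C20 M3]] _] := mS.
have [CD CD0 dbl] := unif_loc_doubling_scale (L / eps).
(* The radius [L eps^k] is too large for (M2) at index [k]; with this [j] it is at most [eps^(k-j)],
   so (M2) applies to [m (k - j)]. *)
have [j Lj] : exists j, L * eps ^+ j <= 1.
  have /cvgrPdist_lt /(_ L^-1) : (fun n => eps ^+ n) @ \oo --> (0 : R).
    by apply: cvg_expr; rewrite gtr0_norm.
  rewrite invr_gt0 => /(_ L0)[j _ /(_ j (leqnn j))].
  rewrite sub0r normrN gtr0_norm ?exprn_gt0// => h; exists j.
  by rewrite mulrC -ler_pdivlMr// div1r ltW.
exists (D j * C1 * CD / C2 * D 1%N), j; split.
  by rewrite !mulr_gt0// invr_gt0.
move=> k x jk Sx.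
have mB r : measurable (B x r) by exact: (measurable_cball dmetric borelT).
pose v := fine (mu (B x (eps ^+ k.+1))).
pose q := ((eps ^+ k.+1) `^ theta)^-1.
have ek0 n : 0 < eps ^+ n by rewrite exprn_gt0.
have v0 : 0 <= v by apply: fine_ge0.
have q0 : 0 <= q by rewrite invr_ge0 powR_ge0.
have Lek : eps ^+ k.+1 <= L * eps ^+ k.
  by rewrite exprS ler_pM2r// (le_trans _ L1)// ltW.
have muv : mu (B x (eps ^+ k.+1)) = v%:E by exact: mu_fin.
have up : (m k (B x (L * eps ^+ k)) <= (D j * C1 * CD * v * q)%:E)%E.
  have -> : k = (k - j + j)%N by rewrite subnK.
  have [_ h] := mC (k - j)%N j _ (mB (L * eps ^+ (k - j + j))).
  apply: (le_trans h); rewrite -!mulrA EFinM lee_wpmul2l ?lee_fin ?(ltW (D0 j))//.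
  apply: (le_trans (M2 _ _ _ _)).
    rewrite mulr_gt0//= exprD mulrCA ler_piMr// ltW//.
  rewrite subnK// -muleA EFinM lee_wpmul2l ?lee_fin ?(ltW C10)//.
  rewrite mulrA EFinM; apply: lee_pmul => //.
  - by rewrite lee_fin invr_ge0 powR_ge0.
  - rewrite EFinM -muv (_ : L * _ = L / eps * eps ^+ k.+1).
      by rewrite dbl// ek0 epsX_le1.
    by rewrite exprS mulrA divfK// gt_eqF.
  - by rewrite lee_fin; apply: powR_inv_le.
split; first exact: (le_lt_trans up (ltry _)).
apply: (le_trans up).
(* (M3) reaches radius [eps^(k+1)] only for [m k.+1], whence the factor [D 1]. *)
have low : ((C2 * v * q)%:E <= (D 1%N)%:E * m k (B x (eps ^+ k.+1)))%E.
  have [_] := mC k 1%N _ (mB (eps ^+ k.+1)); apply: le_trans; rewrite addn1.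
  have := M3 k.+1 x (eps ^+ k.+1) Sx; rewrite lexx epsX_le1 => /(_ isT).
  by rewrite muv -!EFinM.
have -> : D j * C1 * CD * v * q = D j * C1 * CD / C2 * (C2 * v * q).
  by field; rewrite gt_eqF.
rewrite EFinM [in leRHS]EFinM -muleA lee_wpmul2l// lee_fin.
by rewrite ltW// !mulr_gt0// invr_gt0.
Qed.

End MeasureFamily.

(** * The scale index [kr] *)

Section Scales.
Context {R : realType} {eps : R}.
Hypotheses (eps0 : 0 < eps) (eps1 : eps < 1).

(** The half-open intervals from [eps^(n+1)] (excluded) to [eps^n] (included) are disjoint, so the
    choice made by [xget] is determined. *)
Lemma kr_unique r n : r <= eps ^+ n -> eps ^+ n.+1 < r -> kr eps r = n.
Proof.
move=> rn nr; rewrite /kr; apply: xget_unique => // k [rk kr].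
have aux i j : r <= eps ^+ j -> eps ^+ i.+1 < r -> (j <= i)%N.
  move=> rj ir; rewrite leqNgt; apply/negP => ij.
  have : eps ^+ j <= eps ^+ i.+1 by apply: ler_wiXn2l => //; rewrite ltW.
  by move=> /(le_trans rj)/(lt_le_trans ir); rewrite ltxx.
by apply/eqP; rewrite eqn_leq !aux.
Qed.

Lemma kr_spec r : 0 < r <= 1 -> r <= eps ^+ kr eps r /\ eps ^+ (kr eps r).+1 < r.
Proof.
move=> /andP[r0 r1].
have exn : exists n, eps ^+ n.+1 < r.
  have /cvgrPdist_lt /(_ r r0)[n _ /(_ n.+1 (leqnSn n))] :
      (fun n => eps ^+ n) @ \oo --> (0 : R).
    by apply: cvg_expr; rewrite gtr0_norm.
  by rewrite sub0r normrN gtr0_norm ?exprn_gt0//; exists n.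
case: (ex_minnP exn) => n nr minn.
have rn : r <= eps ^+ n.
  case: n nr minn => [|n] nr minn; first by rewrite expr0.
  by rewrite leNgt; apply/negP => /minn; rewrite ltnn.
by rewrite (kr_unique rn nr).
Qed.

End Scales.

(** * Weak-type estimate for the oscillation at one scale *)

Section WeakType.
Context {R : realType} {dd : measure_display} {T : measurableType dd}.
Context {dist : T -> T -> R} {mu : {measure set T -> \bar R}}.
Context {p theta eps c delta : R} {S : set T}.
Context {m : nat -> {measure set T -> \bar R}} {f : T -> R}.
Local Notation B := (cball dist).

(** The norm term is nonnegative, so the supremum is finite; its [p]-th power removes the outer
    root. *)
Lemma BSN_sum_bound : 1 < p ->
  (BSN dist mu m eps S p c delta f < +oo)%E ->
  exists2 K : R, 0 <= K & forall n xs rs, nice dist S c delta n xs rs ->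
    (\sum_(i < n) (mu (B (xs i) (rs i)) * ((rs i) `^ (- p))%:E *
       poweR (osct dist (m (kr eps (rs i))) f (xs i) (c * rs i)) p) <= K%:E)%E.
Proof.
move=> p1; have p0 : 0 < p by exact: lt_trans p1.
rewrite /BSN; set A := [set s | _]; move=> fin.
have sup_lty : (ereal_sup A < +oo)%E.
  rewrite ltNge leye_eq; apply/negP => /eqP supy.
  by move: fin; rewrite supy addey ?ltxx// -ltNye (lt_le_trans _ (Lnorm_ge0 _ _ _)).
have inA n xs rs : nice dist S c delta n xs rs -> A _ :=
  fun h => ex_intro _ n (ex_intro _ xs (ex_intro _ rs (conj h erefl))).
exists (fine (ereal_sup A) `^ p); first exact: powR_ge0.
move=> n xs rs /inA; set s := (\sum_(i < n) _)%E => /ereal_sup_ubound s_le.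
have s0 : (0 <= s)%E.
  apply: sume_ge0 => i _; rewrite !mule_ge0// ?poweR_ge0//.
  by rewrite lee_fin powR_ge0.
have -> : s = poweR (poweR s p^-1) p.
  by rewrite -poweRrM mulVf ?gt_eqF// poweRe1.
have sup0 : (0 <= ereal_sup A)%E by apply: le_trans s_le; exact: poweR_ge0.
rewrite -poweR_EFin fineK ?ge0_fin_numE//.
apply: gt0_ler_poweR => //; rewrite ?(ltW p0)// in_itv /= ?poweR_ge0 ?sup0/= leey//.
Qed.

Hypotheses (dmetric : is_metric dist) (borelT : borel_compatible dist).
Hypothesis sepT : dseparable dist.

(** A Chebyshev argument on the covering by tripled balls. The set [A'] is that covering, which is
    measurable without any measurability of the oscillation in [x]. *)
Lemma osc_weak_type (K C t : R) (k : nat) : 1 < c -> 0 < p -> 0 < eps < 1 ->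
  eps ^+ k <= delta -> supp dist (m k) = S -> 0 <= C -> 0 <= K -> 0 < t ->
  (forall n xs rs, nice dist S c delta n xs rs ->
    (\sum_(i < n) (mu (B (xs i) (rs i)) * ((rs i) `^ (- p))%:E *
       poweR (osct dist (m (kr eps (rs i))) f (xs i) (c * rs i)) p) <= K%:E)%E) ->
  (forall x, (m 0%N (B x (3 * eps ^+ k)) <=
     C%:E * (mu (B x (eps ^+ k)) * (((eps ^+ k) `^ theta)^-1)%:E))%E) ->
  exists A', [/\ measurable A',
    (m 0%N A' <= (C * ((eps ^+ k) `^ theta)^-1 * (eps ^+ k) `^ p / t `^ p * K)%:E)%E &
    S `&` [set x | t%:E < osc (m k) f (B x (2 * c * eps ^+ k))]%E `<=` A'].
Proof.
move=> c1 p0 /andP[eps0 eps1] rdelta suppm C0 K0 t0 Kbnd tripl.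
set r := eps ^+ k; have r0 : 0 < r by rewrite exprn_gt0.
set A := S `&` _; set M := _ / _.
have M0 : 0 <= M.
  by rewrite !(mulr_ge0, invr_ge0, powR_ge0).
have [A0|/set0P A0] := eqVneq A set0.
  exists set0; split=> //; last by rewrite A0.
  by rewrite measure0 lee_fin mulr_ge0.
have mB x s : measurable (B x s) by exact: (measurable_cball dmetric borelT).
have [D [a [Da tD Acov]]] := disjoint_cball_cover dmetric sepT r0 A0.
pose F n := if n \in D then B (a n) (3 * r) else set0.
have mF n : measurable (F n) by rewrite /F; case: ifP.
exists (\bigcup_n F n); split; first exact: bigcup_measurable.
  apply: (le_trans (measure_sigma_subadditive _ mF _ _)) => //.
    exact: bigcup_measurable.
  apply: lime_le; first by apply: is_cvg_nneseries => n _ _.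
  near=> N.
  (* Nice families are finite, so only the members of [D] below [N] are used; the bound is uniform
     in [N]. *)
  pose s := [seq i <- iota 0 N | i \in D].
  have -> : (\sum_(0 <= i < N) m 0%N (F i) =
             \sum_(i <- s) m 0%N (B (a i) (3 * r)))%E.
    rewrite /s big_filter [RHS]big_mkcond /index_iota subn0; apply: eq_bigr => i _.
    by rewrite /F; case: ifP; rewrite ?measure0.
  have sD i : (i < size s)%N -> D (nth 0%N s i).
    by move=> /(mem_nth 0%N); rewrite mem_filter => /andP[/set_mem].
  have := Kbnd (size s) (fun i => a (nth 0%N s i)) (fun=> r) _.
  rewrite -(big_mkord xpredT (fun i => mu (B (a (nth 0%N s i)) r) * (r `^ (- p))%:E *
     poweR (osct dist (m (kr eps r)) f (a (nth 0%N s i)) (c * r)) p)%E).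
  rewrite -(big_nth 0%N xpredT (fun i => mu (B (a i) r) * (r `^ (- p))%:E *
     poweR (osct dist (m (kr eps r)) f (a i) (c * r)) p)%E).
  have krr : kr eps r = k.
    by apply: kr_unique => //; rewrite /r exprS gtr_pMl.
  move=> Ks; rewrite EFinM; apply: (@le_trans _ _ (M%:E *
    \sum_(i <- s) (mu (B (a i) r) * (r `^ (- p))%:E *
     poweR (osct dist (m (kr eps r)) f (a i) (c * r)) p))%E); last first.
    rewrite lee_wpmul2l//; apply: Ks; split.
    - move=> i /sD/Da[Sa _]; rewrite r0 rdelta; split=> //.
      by exists (a (nth 0%N s i)); split=> //; apply: cball_center => //; rewrite mulr_ge0 ?ltW// (lt_trans ltr01).
    - move=> i j /[dup] isz /sD Di /[dup] jsz /sD Dj ij.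
      apply/eqP/negPn/negP => /set0P.
      move=> /(tD _ _ Di Dj) /eqP.
      rewrite nth_uniq//; first by move/eqP.
      by rewrite filter_uniq// iota_uniq.
  rewrite ge0_sume_distrr; last first.
    by move=> i _; rewrite !mule_ge0// ?poweR_ge0// lee_fin powR_ge0.
  rewrite !big_seq; apply: lee_sum => i; rewrite mem_filter => /andP[/set_mem/Da[Sa osca] _].
  apply: (le_trans (tripl (a i))); rewrite -/r.
  (* The centre lies in [S], the support of [m k], so [osct] takes its nontrivial branch, and its
     doubled radius [2 (c r)] is the one in the bad set. *)
  have osct_ge : (t%:E <= osct dist (m (kr eps r)) f (a i) (c * r))%E.
    rewrite krr /osct suppm asboolT; last first.
      exists (a i); split=> //; apply: cball_center => //.
      by rewrite mulr_ge0 ?ltW// (lt_trans ltr01).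
    by rewrite mulrA; exact: ltW.
  have t_le : ((t `^ p)%:E <= poweR (osct dist (m (kr eps r)) f (a i) (c * r)) p)%E.
    rewrite -poweR_EFin; apply: gt0_ler_poweR => //; rewrite ?(ltW p0)//.
      by rewrite in_itv /= lee_fin ltW//= leey.
    by rewrite in_itv /= leey andbT (le_trans _ osct_ge)// lee_fin ltW.
  apply: (@le_trans _ _ (M%:E * (mu (B (a i) r) * (r `^ (- p))%:E * (t `^ p)%:E))%E).
    have aux (u v w : R) (y : \bar R) :
        (u%:E * (y * v%:E * w%:E) = (u * (v * w))%:E * y)%E.
      by rewrite !EFinM -!muleA; congr (_ * _)%E; rewrite muleC -muleA.
    rewrite aux (muleC (mu _)) muleA -EFinM lee_wpmul2r// lee_fin le_eqVlt.
    apply/orP; left; apply/eqP.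
    by rewrite /M powRN; field; rewrite !gt_eqF ?powR_gt0.
  by rewrite lee_wpmul2l// lee_wpmul2l// mule_ge0// lee_fin powR_ge0.
move=> x Ax; have [n Dn xn] := Acov x Ax.
by exists n => //; rewrite /F mem_set.
Unshelve. all: by end_near. Qed.

End WeakType.

(** * Mean deviations from constants and geometric increments *)

Section MeanDeviation.
Context {R : realType} {dd : measure_display} {T : measurableType dd}.
Context {m : {measure set T -> \bar R}} {f : T -> R} {D : set T}.
Hypotheses (mD : measurable D) (mf : measurable_fun [set: T] f).

Lemma measurable_fun_dist (E : set T) (e : R) :
  measurable_fun E (fun x => `|f x - e|%:E).
Proof.
apply/measurable_EFinP/measurableT_comp => //.
by apply: measurable_funB => //; exact: measurable_funTS.
Qed.

Lemma integral_dist_cst (a b : R) :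
  (\int[m]_(x in D) `|f x - a|%:E <=
     \int[m]_(x in D) `|f x - b|%:E + `|a - b|%:E * m D)%E.
Proof.
have mfe e := @measurable_fun_dist D e.
rewrite -integral_cst// -ge0_integralD//; last by move=> x _; rewrite lee_fin.
apply: ge0_le_integral => //.
- by apply: emeasurable_funD => //; exact: measurable_cst.
- move=> x _ /=; rewrite -EFinD lee_fin (distrC a b).
  by apply: le_trans (ler_normD _ _); rewrite addrA subrK.
Qed.

Lemma dist_cst_measure_le (a b : R) :
  (`|a - b|%:E * m D <=
     \int[m]_(x in D) `|f x - a|%:E + \int[m]_(x in D) `|f x - b|%:E)%E.
Proof.
have mfe e := @measurable_fun_dist D e.
rewrite -integral_cst// -ge0_integralD//; apply: ge0_le_integral => //.
- by move=> x _; rewrite lee_fin.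
- by apply: emeasurable_funD.
- move=> x _ /=; rewrite -EFinD lee_fin (distrC (f x) a).
  by apply: le_trans (ler_normD _ _); rewrite addrA subrK.
Qed.

Lemma dist_lower_bound_measure_le (E : set T) (a g : R) : measurable E ->
  0 <= g -> E `<=` D -> (forall x, E x -> g <= `|f x - a|) ->
  (g%:E * m E <= \int[m]_(x in D) `|f x - a|%:E)%E.
Proof.
move=> mE g0 ED gE; rewrite -integral_cst//.
apply: (@le_trans _ _ (\int[m]_(x in E) `|f x - a|%:E)%E).
  by apply: ge0_le_integral => //; exact: measurable_fun_dist.
apply: ge0_subset_integral => //; exact: measurable_fun_dist.
Qed.

(** The infimum over constants need not be known to be attained; a strict bound still yields a
    constant. *)
Lemma osc_lt_witness (t : R) : (0 < m D)%E -> (m D < +oo)%E ->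
  (osc m f D < t%:E)%E ->
  exists a, (\int[m]_(x in D) `|f x - a|%:E <= t%:E * m D)%E.
Proof.
move=> mD0 mDoo /ereal_inf_lt[y [a _ ay]]; rewrite -{}ay => /ltW h; exists a.
have v0 : 0 < fine (m D) by rewrite fine_gt0// mD0.
move: h; rewrite lee_pdivrMl// => h; apply: (le_trans h).
by rewrite muleC fineK// ge0_fin_numE.
Qed.

End MeanDeviation.

Lemma geometric_increments {R : realType} (a : nat -> R) (C t : R) K :
  0 <= t < 1 -> 0 <= C ->
  (forall k, (K <= k)%N -> `|a k - a k.+1| <= C * t ^+ k) ->
  forall k n, (K <= k)%N -> (k <= n)%N -> `|a k - a n| <= C / (1 - t) * t ^+ k.
Proof.
move=> /andP[t0 t1] C0 step k n Kk kn; rewrite -(subnKC kn).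
have t1' : 0 < 1 - t by rewrite subr_gt0.
(* The partial geometric sum is kept exact so that the induction closes. *)
suff h i : `|a k - a (k + i)%N| <= C / (1 - t) * (t ^+ k - t ^+ (k + i)).
  apply: (le_trans (h _)); rewrite ler_wpM2l ?divr_ge0 ?(ltW t1')//.
  by rewrite gerBl exprn_ge0.
elim: i => [|i IH]; first by rewrite addn0 !subrr normr0 mulr0.
rewrite addnS; apply: le_trans (ler_distD (a (k + i)%N) _ _) _.
have := step _ (leq_trans Kk (leq_addr i k)); move: IH.
have -> : C * t ^+ (k + i) = C / (1 - t) * (t ^+ (k + i) - t ^+ (k + i).+1).
  by rewrite exprS; field; rewrite gt_eqF.
lra.
Qed.

(** * Convergence at a point with small oscillations *)

Section Pointwise.
Context {R : realType} {dd : measure_display} {T : measurableType dd}.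
Context {dist : T -> T -> R} {m : nat -> {measure set T -> \bar R}}.
Context {f : T -> R} {x : T} {eps tau L A : R} {K : nat}.
Local Notation B := (cball dist).
Local Notation G k := (B x (L * eps ^+ k)).
Hypotheses (dmetric : is_metric dist) (borelT : borel_compatible dist).
Hypothesis mf : measurable_fun [set: T] f.
Hypotheses (eps0 : 0 < eps) (eps1 : eps < 1) (tau0 : 0 < tau) (tau1 : tau < 1).
Hypotheses (L1 : 1 <= L) (A0 : 0 < A).
Hypothesis x_supp : forall k r, 0 < r -> (0 < m k (B x r))%E.
Hypothesis osc_small : forall k, (K <= k)%N -> (osc (m k) f (G k) <= (tau ^+ k)%:E)%E.
Hypothesis growth : forall k, (K <= k)%N -> (m k (G k) < +oo /\
  m k (G k) <= A%:E * m k (B x (eps ^+ k.+1)))%E.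
Hypothesis comparable : forall k D, measurable D ->
  (m k D <= A%:E * m k.+1 D /\ m k.+1 D <= A%:E * m k D)%E.
(* Supplied by (M5) for the level sets of f around f x. *)
Hypothesis approx_upper_density : forall g : R, 0 < g -> exists E : set T,
  [/\ measurable E, forall y, E y -> `|f y - f x| <= g &
      0 < limn_sup (fun k => fine (m k (B x (eps ^+ k) `&` E)) /
                             fine (m k (B x (eps ^+ k))))].

Let mB r : measurable (B x r). Proof. exact: (measurable_cball dmetric borelT). Qed.

Let epsX0 k : 0 < eps ^+ k. Proof. exact: exprn_gt0. Qed.

Let G0 k : (0 < m k (G k))%E.
Proof. by apply: x_supp; rewrite mulr_gt0// (lt_le_trans ltr01). Qed.

Let ball_sub k r : r <= eps ^+ k -> B x r `<=` G k.
Proof.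
move=> rk; apply: subset_cball_radius => //; apply: (le_trans rk).
by rewrite ler_peMl// ltW.
Qed.

Let ball_fin k r : (K <= k)%N -> r <= eps ^+ k -> (m k (B x r) < +oo)%E.
Proof.
move=> Kk rk; apply: le_lt_trans (growth Kk).1.
by apply: le_measure; rewrite ?inE//; exact: ball_sub.
Qed.

Lemma local_centers : exists (a : nat -> R) (C : R),
  [/\ 0 <= C,
   forall k r, (K <= k)%N -> eps ^+ k.+1 <= r ->
     (\int[m k]_(y in G k) `|f y - a k|%:E <=
       (2 * tau ^+ k * A)%:E * m k (B x r))%E &
   forall k n, (K <= k)%N -> (k <= n)%N -> `|a k - a n| <= C * tau ^+ k].
Proof.
have tX0 k : 0 < tau ^+ k by exact: exprn_gt0.
(* The factor 2 provides the strict inequality required for a witness. *)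
have /choice[a aP] k : exists a, (K <= k)%N ->
    (\int[m k]_(y in G k) `|f y - a|%:E <= (2 * tau ^+ k)%:E * m k (G k))%E.
  have [Kk|kK] := leqP K k; last by exists 0.
  have [|a ak] := osc_lt_witness (m := m k) (f := f) (t := 2 * tau ^+ k) (G0 k) (growth Kk).1.
    by apply: (le_lt_trans (osc_small Kk)); rewrite lte_fin ltr_pMl// ltr1n.
  by exists a.
have aG k r : (K <= k)%N -> eps ^+ k.+1 <= r ->
     (\int[m k]_(y in G k) `|f y - a k|%:E <=
       (2 * tau ^+ k * A)%:E * m k (B x r))%E.
  move=> Kk kr; apply: (le_trans (aP k Kk)).
  rewrite [in leRHS]EFinM -muleA lee_wpmul2l ?lee_fin ?mulr_ge0 ?(ltW (tX0 k))//.
  apply: (le_trans (growth Kk).2); rewrite lee_wpmul2l ?lee_fin ?(ltW A0)//.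
  by apply: le_measure; rewrite ?inE//; exact: subset_cball_radius.
(* [2 A^3] comes from the centre [a k] (bound [I1]), [2 A] from [a k.+1] (bound [I2]), and
   [1 / (1 - tau)] from the geometric sum. *)
exists a, ((2 * A ^+ 3 + 2 * A) / (1 - tau)); split=> //.
  have A0' := ltW A0; apply: divr_ge0; last by rewrite subr_ge0 ltW.
  by rewrite addr_ge0// mulr_ge0// exprn_ge0.
apply: geometric_increments; first by rewrite ltW.
  by have A0' := ltW A0; rewrite addr_ge0// mulr_ge0// exprn_ge0.
move=> k Kk; have KSk := leqW Kk; set b := B x (eps ^+ k.+1).
have b0 : (0 < m k.+1 b)%E by exact: x_supp.
have bE : m k.+1 b = (fine (m k.+1 b))%:E.
  by rewrite fineK// ge0_fin_numE//; exact: ball_fin.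
have v0 : 0 < fine (m k.+1 b) by rewrite -lte_fin -bE.
have bG n : (n <= k.+1)%N -> b `<=` G n.
  by move=> nk; apply: ball_sub; rewrite ler_wiXn2l ?ltW.
have subI n e : (n <= k.+1)%N ->
    (\int[m n]_(y in b) `|f y - e|%:E <= \int[m n]_(y in G n) `|f y - e|%:E)%E.
  move=> nk; apply: ge0_subset_integral.
  - exact: mB.
  - exact: mB.
  - exact: measurable_fun_dist.
  - by move=> y _; rewrite lee_fin.
  - exact: bG.
(* One factor [A] passes from [m k.+1] to [m k], one compares [G k] with [b], and one returns to
   [m k.+1]. *)
have I1 : (\int[m k.+1]_(y in b) `|f y - a k|%:E <=
    (A * (2 * tau ^+ k * A * A))%:E * m k.+1 b)%E.
  apply: (@le_trans _ _ (A%:E * \int[m k]_(y in b) `|f y - a k|%:E)%E).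
    apply: ge0_le_integral_dominated.
    - exact: ltW.
    - by move=> E mE; exact: (comparable k mE).2.
    - exact: mB.
    - by move=> y; rewrite lee_fin.
    - exact: measurable_fun_dist.
  rewrite EFinM -muleA lee_wpmul2l ?lee_fin ?(ltW A0)//.
  apply: (le_trans (subI _ _ (leqnSn k))).
  apply: (le_trans (aG _ _ Kk (lexx _))).
  rewrite [in leRHS]EFinM -muleA lee_wpmul2l//.
    by rewrite lee_fin !mulr_ge0// ltW.
  exact: (comparable k (mB _)).1.
have I2 : (\int[m k.+1]_(y in b) `|f y - a k.+1|%:E <=
    (2 * tau ^+ k * A)%:E * m k.+1 b)%E.
  apply: (le_trans (subI _ _ (leqnn _))); apply: (le_trans (aG _ (eps ^+ k.+1) KSk _)).
    by rewrite ler_wiXn2l ?ltW.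
  rewrite lee_wpmul2r// lee_fin ler_pM2r// ler_pM2l// ler_wiXn2l ?ltW//.
(* The measure of [b] is positive and finite, hence cancels and leaves a bound on
   [|a k - a k.+1|]. *)
have := le_trans (dist_cst_measure_le (m := m k.+1) (mB _) mf (a k) (a k.+1)) (leeD I1 I2).
rewrite -/b bE -!EFinM -EFinD lee_fin -mulrDl ler_pM2r// => h.
by apply: (le_trans h); rewrite le_eqVlt; apply/orP; left; apply/eqP; ring.
Qed.

Let tauX_small e : 0 < e -> exists N, forall n, (N <= n)%N -> tau ^+ n <= e.
Proof.
move=> e0; have /cvgrPdist_le /(_ e e0)[N _ h] : (fun n => tau ^+ n) @ \oo --> (0 : R).
  by apply: cvg_expr; rewrite gtr0_norm.
by exists N => n /h /=; rewrite sub0r normrN gtr0_norm// exprn_gt0.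
Qed.

(** If [a k] were farther than [C tau^k] from [f x], all later [a n] would stay at distance at least
    [g] from [f x]. Points where [f] is within [g / 2] of [f x] would then have density of order
    [tau^n] in the balls, against the positive upper density. *)
Lemma centers_approach_value : exists (a : nat -> R) (C : R),
  [/\ 0 <= C,
   forall k r, (K <= k)%N -> eps ^+ k.+1 <= r ->
     (\int[m k]_(y in G k) `|f y - a k|%:E <=
       (2 * tau ^+ k * A)%:E * m k (B x r))%E &
   forall k, (K <= k)%N -> `|a k - f x| <= C * tau ^+ k].
Proof.
have [a [C [C0 aG aC]]] := local_centers.
exists a, C; split=> // k Kk; rewrite leNgt; apply/negP => far.
pose g : R := `|a k - f x| - C * tau ^+ k.
have g0 : 0 < g by rewrite subr_gt0.
have far_n n : (k <= n)%N -> g <= `|a n - f x|.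
  move=> kn; rewrite lerBlDr (le_trans (ler_distD (a n) _ _))// addrC lerD2l.
  exact: aC.
have [|E [mE Eg]] := approx_upper_density (g := g / 2); first exact: divr_gt0.
set u := (u in limn_sup u).
suff /cvg_limn_inf_sup[_ ->] : u @ \oo --> (0 : R) by rewrite ltxx.
(* The majorant comes from [g/2 m_n(b & E) <= 2 tau^n A m_n(b)], where [b & E] is the
   intersection. *)
rewrite {}/u.
apply: (@squeeze_cvgr _ _ _ _ (fun=> 0) (fun n => 4 * A / g * tau ^+ n)); last 2 first.
- exact: cvg_cst.
- rewrite -[X in _ --> X](mulr0 (4 * A / g)); apply: cvgMr.
  by apply: cvg_expr; rewrite gtr0_norm.
near=> n.
have kn : (k <= n)%N by near: n; exists k.
have Kn := leq_trans Kk kn.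
set b := B x (eps ^+ n).
have bfin : (m n b < +oo)%E by exact: (ball_fin Kn (lexx _)).
have b0 : (0 < m n b)%E by exact: x_supp.
have v0 : 0 < fine (m n b) by rewrite fine_gt0// b0.
have bE : m n b = (fine (m n b))%:E by rewrite fineK// ge0_fin_numE.
have mbE : measurable (b `&` E) by apply: measurableI => //; exact: mB.
have bEE : m n (b `&` E) = (fine (m n (b `&` E)))%:E.
  rewrite fineK// ge0_fin_numE//; apply: le_lt_trans bfin.
  by apply: le_measure; rewrite ?inE//; exact: mB.
rewrite divr_ge0 ?fine_ge0//= ler_pdivrMr//.
have bEG : b `&` E `<=` G n.
  by move=> z [bz _]; apply: (ball_sub (lexx (eps ^+ n))).
have gbE y : (b `&` E) y -> g / 2 <= `|f y - a n|.
  move=> [_ /Eg fy]; have := far_n n kn.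
  have := ler_distD (f y) (a n) (f x); rewrite (distrC (a n) (f y)); lra.
have h := dist_lower_bound_measure_le (m := m n) (mB _) mf mbE
  (ltW (divr_gt0 g0 (ltr0n R 2))) bEG gbE.
have : g / 2 * fine (m n (b `&` E)) <= 2 * tau ^+ n * A * fine (m n b).
  rewrite -lee_fin (EFinM (g / 2)) (EFinM (_ * A)) -bEE -bE; apply: (le_trans h).
  by apply: aG => //; rewrite ler_wiXn2l ?ltW.
move=> {h}h; rewrite -(ler_pM2l (divr_gt0 g0 (ltr0n R 2))); apply: (le_trans h).
rewrite le_eqVlt; apply/orP; left; apply/eqP; field; exact: lt0r_neq0.
Unshelve. all: by end_near. Qed.

Lemma leb_avg_cvg0 : leb_avg dist m eps f x r @[r --> 0^'+] --> 0%E.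
Proof.
have [a [C [C0 aG aC]]] := centers_approach_value.
have bound r : 0 < r <= eps ^+ K ->
    (0 <= leb_avg dist m eps f x r <=
      ((2 * A + C) * tau ^+ kr eps r)%:E)%E /\ (K <= kr eps r)%N.
  move=> /andP[r0 rK]; have r1 : 0 < r <= 1.
    by rewrite r0 (le_trans rK)// exprn_ile1 ?ltW.
  (* The upper bound on [r] puts [B x r] inside [G k]; the lower bound makes the measure of [B x r]
     comparable to that of [G k]. *)
  have [rk kr] := kr_spec eps0 eps1 r1; rewrite /leb_avg.
  set k := Defs.kr eps r in rk kr *.
  have Kk : (K <= k)%N.
    rewrite leqNgt; apply/negP => kK.
    have : eps ^+ K <= eps ^+ k.+1 by rewrite ler_wiXn2l ?ltW.
    by move=> /(le_trans rK)/(lt_le_trans kr); rewrite ltxx.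
  have bfin : (m k (B x r) < +oo)%E by apply: ball_fin.
  have v0 : 0 < fine (m k (B x r)) by rewrite fine_gt0// x_supp.
  have bE : m k (B x r) = (fine (m k (B x r)))%:E by rewrite fineK// ge0_fin_numE.
  split=> //; apply/andP; split.
    rewrite mule_ge0 ?lee_fin ?invr_ge0 ?fine_ge0//.
    by apply: integral_ge0 => y _; rewrite lee_fin.
  rewrite lee_pdivrMl// -bE.
  under eq_integral do rewrite distrC.
  apply: (le_trans (integral_dist_cst (m := m k) (mB r) mf (f x) (a k))).
  rewrite (mulrDl _ C) EFinD [leRHS]muleC ge0_muleDl ?lee_fin; last 2 first.
  - by rewrite !mulr_ge0 ?exprn_ge0 ?(ltW A0) ?(ltW tau0).
  - by rewrite mulr_ge0 ?exprn_ge0 ?(ltW tau0).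
  apply: leeD; last by rewrite lee_wpmul2r// lee_fin distrC aC.
  apply: (@le_trans _ _ (\int[m k]_(y in G k) `|f y - a k|%:E)%E).
    apply: ge0_subset_integral.
    - exact: mB.
    - exact: mB.
    - exact: measurable_fun_dist.
    - by move=> y _; rewrite lee_fin.
    - exact: ball_sub.
  by apply: (le_trans (aG _ _ Kk (ltW kr))); rewrite mulrAC.
apply/fine_cvgP; split.
  near=> r; have [|/andP[h0 h1] _] := bound r.
    by apply/andP; split; near: r; [exact: nbhs_right_gt|exact: nbhs_right_le].
  by rewrite ge0_fin_numE// (le_lt_trans h1)// ltry.
apply/cvgrPdist_le => e e0.
have M0 : 0 < 2 * A + C + 1 by have := A0; have := C0; lra.
have [N tN] := tauX_small (divr_gt0 e0 M0).
near=> r; rewrite sub0r normrN.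
have r0 : 0 < r by near: r; exact: nbhs_right_gt.
have [|/andP[h0 h1] _] := bound r.
  by rewrite r0 /=; near: r; exact: nbhs_right_le.
have r1 : 0 < r <= 1.
  by rewrite r0 /=; near: r; exact: nbhs_right_le.
have [rk kr] := kr_spec eps0 eps1 r1.
have Nk : (N <= Defs.kr eps r)%N.
  rewrite leqNgt; apply/negP => kN.
  have rN : r <= eps ^+ N by near: r; exact: nbhs_right_le.
  have : eps ^+ N <= eps ^+ (Defs.kr eps r).+1 by rewrite ler_wiXn2l ?ltW.
  by move=> /(le_trans rN)/(lt_le_trans kr); rewrite ltxx.
have fin : leb_avg dist m eps f x r \is a fin_num.
  by rewrite ge0_fin_numE// (le_lt_trans h1)// ltry.
rewrite /= ger0_norm ?fine_ge0// -lee_fin fineK//; apply: (le_trans h1).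
rewrite lee_fin; have := tN _ Nk; rewrite ler_pdivlMr// => h.
apply: le_trans h; rewrite mulrC ler_wpM2l ?exprn_ge0 ?ltW//.
by rewrite ltrDl.
Unshelve. all: by end_near. Qed.

End Pointwise.

(** * Borel-Cantelli and almost everywhere decay of the oscillation *)

Lemma negligible_lim_sup_geometric {R : realType} {dd : measure_display}
    {T : measurableType dd} (m : {measure set T -> \bar R}) (F : nat -> set T) (M s : R) :
  (forall k, measurable (F k)) -> 0 <= M -> 0 < s < 1 ->
  (forall k, (m (F k) <= (M * s ^+ k)%:E)%E) -> m.-negligible (lim_sup_set F).
Proof.
move=> mF M0 /andP[s0 s1] mFk.
have mlim : measurable (lim_sup_set F).
  by apply: bigcap_measurable => // k _; apply: bigcup_measurable.
apply/(negligibleP m mlim); apply: lim_sup_set_cvg0 => //.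
apply: (@le_lt_trans _ _ (M / (1 - s))%:E); last exact: ltry.
apply: lime_le; first by apply: is_cvg_nneseries => n _ _.
near=> n; apply: (@le_trans _ _ (\sum_(0 <= k < n) (M * s ^+ k)%:E)%E).
  by apply: lee_sum => k _.
rewrite sumEFin lee_fin.
have : series (geometric M s) n <= M / (1 - s).
  by apply: geometric_le_lim => //; rewrite gtr0_norm.
by [].
Unshelve. all: by end_near. Qed.

Lemma powR_lt1 {R : realType} (a r : R) : 0 < a < 1 -> 0 < r -> a `^ r < 1.
Proof.
move=> /andP[a0 a1] r0.
have -> : 1 = 1 `^ r by rewrite powR1.
by apply: gt0_ltr_powR => //; rewrite nnegrE ltW.
Qed.

Lemma powR_exprn {R : realType} (a r : R) n : 0 <= a -> (a ^+ n) `^ r = (a `^ r) ^+ n.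
Proof.
move=> a0.
by rewrite -(powR_mulrn n a0) -(powR_mulrn n (powR_ge0 a r)) powRAC.
Qed.

Section SmallOscillation.
Context {R : realType} {dd : measure_display} {T : measurableType dd}.
Context {dist : T -> T -> R} {mu : {measure set T -> \bar R}}.
Context {p theta eps c delta : R} {S : set T}.
Context {m : nat -> {measure set T -> \bar R}} {f : T -> R}.
Hypotheses (mmT : mm_space dist mu) (dblT : unif_loc_doubling dist mu).
Hypotheses (p1 : 1 < p) (theta0 : 0 <= theta) (thetap : theta < p).
Hypotheses (clS : dclosed dist S) (eps0 : 0 < eps) (eps10 : eps <= 10^-1).
Hypothesis mS : frakM dist mu theta eps S m.
Hypotheses (c1 : 1 < c) (delta0 : 0 < delta).
Hypothesis BSNf : (BSN dist mu m eps S p c delta f < +oo)%E.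
Local Notation B := (cball dist).
(* The exponent makes tau^(k p) = eps^(k (p - theta) / 2). *)
Local Notation tau := (eps `^ ((p - theta) / (2 * p))).

Lemma ae_osc_eventually_small : exists N, (m 0%N).-negligible N /\
  forall x, S x -> ~ N x -> exists K, forall k, (K <= k)%N ->
    (osc (m k) f (B x (2 * c * eps ^+ k)) <= (tau ^+ k)%:E)%E.
Proof.
have [dmetric _ sepT borelT _] := mmT.
have eps1 : eps < 1 by apply: le_lt_trans eps10 _; lra.
have p0 : 0 < p by exact: lt_trans p1.
have [C C0 trip] := frakM_triple_ball mmT dblT theta0 clS eps0 eps10 mS.
have [K K0 Kbnd] := BSN_sum_bound p1 BSNf.
have m_supp k : supp dist (m k) = S by have [_ -> _ _ _] := mS.
pose s := eps `^ ((p - theta) / 2).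
have s0 : 0 < s by rewrite powR_gt0.
have s1 : s < 1 by apply: powR_lt1; rewrite ?divr_gt0 ?subr_gt0 ?eps0.
have tau0 : 0 < tau by rewrite powR_gt0.
have [k0 k0delta] : exists k0, forall k, (k0 <= k)%N -> eps ^+ k <= delta.
  have /cvgrPdist_le /(_ delta delta0)[k0 _ h] :
      (fun k => eps ^+ k) @ \oo --> (0 : R).
    by apply: cvg_expr; rewrite gtr0_norm.
  by exists k0 => k /h /=; rewrite sub0r normrN gtr0_norm// exprn_gt0.
(* Since [eps^p = eps^theta s^2] and [tau^p = s], exactly one factor [s^n] survives. *)
have bndE n : C * ((eps ^+ n) `^ theta)^-1 * (eps ^+ n) `^ p / (tau ^+ n) `^ p * K =
    C * K * s ^+ n.
  have -> : (tau ^+ n) `^ p = s ^+ n.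
    rewrite powR_exprn ?(ltW tau0)// -powRrM; congr (_ `^ _ ^+ _).
    by field; rewrite gt_eqF.
  rewrite !powR_exprn ?(ltW eps0)//.
  have -> : eps `^ p = eps `^ theta * s * s.
    rewrite /s -!powRD; last 2 first.
    - by rewrite (gt_eqF eps0) implybT.
    - by rewrite (gt_eqF eps0) implybT.
    by congr (_ `^ _); field.
  rewrite !exprMn; field.
  by rewrite !expf_neq0// gt_eqF// powR_gt0.
(* The shift by [k0] keeps the radius below [delta]; the successor matches the scales at which the
   tripled-ball estimate holds. *)
have /choice[F FP] k : exists F, [/\ measurable F,
    (m 0%N F <= (C * K * s ^+ k)%:E)%E &
    S `&` [set x | ((tau ^+ (k + k0).+1)%:E <
      osc (m (k + k0).+1) f (B x (2 * c * eps ^+ (k + k0).+1)))%E] `<=` F].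
  have kdelta : eps ^+ (k + k0).+1 <= delta 
    by apply: k0delta; rewrite ltnW// ltnS leq_addl.
  have epsI : 0 < eps < 1 by rewrite eps0.
  have [F [mF Fle Fsub]] := osc_weak_type dmetric borelT sepT c1 p0 epsI kdelta
    (m_supp _) (ltW C0) K0 (exprn_gt0 (k + k0).+1 tau0) Kbnd (trip _).
  exists F; split=> //; apply: (le_trans Fle); rewrite bndE lee_fin.
  rewrite ler_wpM2l ?mulr_ge0 ?(ltW C0)// ler_wiXn2l ?(ltW s0) ?(ltW s1)//.
  by rewrite -addnS leq_addr.
exists (lim_sup_set F); split.
  apply: (@negligible_lim_sup_geometric _ _ _ _ _ (C * K) s) => [k||//|k].
  - by have [] := FP k.
  - by rewrite mulr_ge0// ltW.
  - by rewrite s0.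
  - by have [] := FP k.
move=> x Sx /existsNP[n /not_implyP[_ nFx]].
exists (n + k0).+1 => k nk; rewrite leNgt; apply/negP => osc_k.
have k0k : (k0 < k)%N by apply: leq_trans nk; rewrite ltnS leq_addl.
have kE : k = ((k - k0.+1) + k0).+1 by rewrite -addnS subnK.
apply: nFx; exists (k - k0.+1)%N => /=.
  by rewrite -(leq_add2r k0.+1) subnK// addnS.
by have [_ _] := FP (k - k0.+1)%N; apply; split=> //=; rewrite -kE.
Qed.

End SmallOscillation.

(** * Almost every point of [S] is a Lebesgue point *)

Unset Implicit Arguments.
Set Strict Implicit.

Theorem mainTheorem12 (R : realType) (dd : measure_display) (T : measurableType dd)
  (dist : T -> T -> R) (mu : {measure set T -> \bar R})
  (p theta eps c delta : R) (S : set T)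
  (m : nat -> {measure set T -> \bar R}) (f : T -> R) :
  1 < p ->
  mm_space dist mu ->
  frakA dist mu p ->
  0 <= theta -> theta < p ->
  dclosed dist S ->
  LCR dist mu theta S ->
  0 < eps -> eps <= 10^-1 ->
  frakMstr dist mu theta eps S m ->
  measurable_fun S f ->
  L1loc dist m f ->
  1 < c -> 0 < delta -> delta <= 1 ->
  (BSN dist mu m eps S p c delta f < +oo)%E ->
  (m 0%N).-negligible (S `\` lebesgue_pts dist m eps S f).
Proof.
move=> p1 mmT [dblT _] theta0 thetap clS _ eps0 eps10 [mS m5] _ fL1 c1 delta0 _ BSNf.
have [dmetric _ _ borelT _] := mmT.
have eps1 : eps < 1 by apply: le_lt_trans eps10 _; lra.
have m_supp k : supp dist (m k) = S by have [_ -> _ _ _] := mS.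
have mf : measurable_fun [set: T] f.
  apply: (measurable_fun_cball dmetric borelT) => x r r0.
  by apply/measurable_EFinP; exact: (measurable_int (m 0%N) (fL1 0%N x r r0)).
have mcS : measurable S := measurable_dclosed borelT clS.
have [N [negN oscN]] := ae_osc_eventually_small
  mmT dblT p1 theta0 thetap clS eps0 eps10 mS c1 delta0 BSNf.
have [C [D [C0 D0 mC]]] := frakM_comparable mmT clS eps0 mS.
have L1 : 1 <= 2 * c by lra.
have [C' [j [C'0 grow]]] := frakM_ball_growth mmT dblT theta0 clS eps0 eps10 mS L1.
(* One constant dominates both directions of comparability and the ball growth. *)
pose A := C + D 1%N + C'.
have A0 : 0 < A by rewrite !addr_gt0.
(* rational thresholds make the exceptional sets of (M5) countably many *)
pose h (i : nat) : R := i.+1%:R^-1.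
pose E (n : rat * nat) := S `&` f @^-1` `](ratr n.1 - h n.2), (ratr n.1 + h n.2)[.
have mE n : measurable (E n).
  by apply: measurableI => //; rewrite -[X in measurable X]setTI; exact: mf.
pose Z (i : nat) := if unpickle i is Some n then
  ~` [set x | E n x -> 0 < limn_sup (fun k =>
     fine (m k (cball dist x (eps ^+ k) `&` E n)) / fine (m k (cball dist x (eps ^+ k))))]
  else set0.
have negZ : (m 0%N).-negligible (\bigcup_i Z i).
  apply: negligible_bigcup => i; rewrite /Z; case: unpickle => [n|].
    exact: (m5 (E n) (mE n) (@subIsetl _ _ _)).
  exact: negligible_set0.
apply: negligibleS (negligibleU negN negZ) => x [Sx nleb].
apply: contrapT => /not_orP[nN nZ]; apply: nleb; split=> //.
have [K oscK] := oscN x Sx nN.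
(* From [maxn K j] on, the oscillation bound (index [K]) and the growth bound (index [j]) hold
   together. *)
apply: (@leb_avg_cvg0 _ _ _ dist m f x eps (eps `^ ((p - theta) / (2 * p)))
  (2 * c) A (maxn K j)) => //.
- by rewrite powR_gt0.
- by apply: powR_lt1; rewrite ?eps0// divr_gt0 ?subr_gt0 ?mulr_gt0// (lt_trans _ p1).
- by move=> k r r0; move: Sx r r0; rewrite -(m_supp k).
- by move=> k; rewrite geq_max => /andP[Kk _]; exact: oscK.
- move=> k; rewrite geq_max => /andP[_ jk]; have [Gfin Gle] := grow k x jk Sx.
  split=> //; apply: (le_trans Gle); rewrite lee_wpmul2r// lee_fin lerDr.
  by rewrite addr_ge0// ltW.
- move=> k Q mQ; have := mC k 1%N Q mQ; rewrite addn1 => -[h1 h2]; split.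
    apply: (le_trans h1); rewrite lee_wpmul2r// lee_fin /A -addrA lerDl.
    by rewrite addr_ge0// ltW.
  apply: (le_trans h2); rewrite lee_wpmul2r// lee_fin /A addrAC lerDr.
  by rewrite addr_ge0// ltW.
move=> g g0.
(* An interval of half-width [h i] containing [f x] has length below [g], so [f] stays within [g] of
   [f x] on the level set. *)
have [i ig] : exists i : nat, h i < g / 2.
  have [i _ /(_ i (leqnn i))] := near_infty_natSinv_lt (PosNum (divr_gt0 g0 (ltr0n R 2))).
  by exists i.
have i0 : 0 < h i by rewrite invr_gt0.
have [q] : exists q, ratr q \in `](f x - h i), (f x + h i)[.
  by apply: rat_in_itvoo; lra.
rewrite in_itv /= => /andP[q1 q2].
have ExE : E (q, i) x by split=> //=; rewrite in_itv /=; lra.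
exists (E (q, i)); split=> //.
- move=> y [_] /=; rewrite in_itv /= => /andP[y1 y2].
  by rewrite ler_norml; lra.
- apply: contrapT => nE; apply: nZ; exists (pickle (q, i)); first by [].
  by rewrite /Z pickleK => /(_ ExE).
Qed.
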